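(* Let $X$ be an $n$-element set, $n\ge1$, let $0\le k\le n$, and let $\pi_X\in\Pi_l(X)$ be the labelled set partition into singletons of which exactly $k$ are labelled. Let $P_0(n,k)$ be the number of $\pi\in\Pi_l(X,\pi_X)$ with $\lambda(\pi)\ne0$. Then \[ P_0(n,0)=\sum_{j=0}^{n-1}\binom{n}{j}B(n-j)=B(n+1)-1,\qquad P_0(n,k)=\sum_{j=0}^{n-k}\binom{n-k}{j}B(n-j)\ \text{ for }k\ge1, \] where $B(m)$ denotes the $m$-th Bell number.
   Context: For a finite set $X$ and a symbol $l\notin X$, a labelled set partition of $X$ is $\pi=\{B_1\cup L_1,\dots,B_k\cup L_k\}$ with $\{B_1,\dots,B_k\}$ a set partition of $X$ and $L_i\in\{\emptyset,\{l\}\}$ (labelled block iff $L_i=\{l\}$). $\Pi_l(X)$ is the set of these, ordered by $\sigma\le\pi$ iff every block of $\sigma$ (including $l$ if present) is contained in a block of $\pi$; $\mu$ is its Möbius function. $m(\pi)=1$ if $\pi$ has exactly one labelled block, else $0$. $\Pi_l(X,\pi_X)=\{\pi\in\Pi_l(X):\pi\ge\pi_X,\ \pi\text{ has at least one labelled block}\}$. For $\pi\in\Pi_l(X,\pi_X)$, $\lambda(\pi)=\sum_{\sigma\in\Pi_l(X,\pi_X),\sigma\ge\pi}\mu(\pi,\sigma)m(\sigma)$. *)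

(* Defs.v *)
From HB Require Import structures.
From mathcomp Require Import all_boot all_order all_algebra.

Set Implicit Arguments.
Unset Strict Implicit.
Unset Printing Implicit Defensive.

Import Order.TTheory GRing.Theory Num.Theory.

Local Open Scope order_scope.

(* The recursion of [mobiusE] below; the fuel #|T| exceeds the length of every
   chain of T that ends strictly below y, so it never runs out. *)
Fixpoint mobius_rec d (T : finPOrderType d) (m : nat) (x y : T) : int :=
  if m is m'.+1 then
    if x == y then 1%R
    else if x < y then (- \sum_(z : T | (x <= z < y)%O) mobius_rec m' x z)%R
    else 0%R
  else 0%R.

Definition mobius d (T : finPOrderType d) (x y : T) : int :=
  mobius_rec #|T| x y.

Lemma mobius_rec_stable d (T : finPOrderType d) (m1 m2 : nat) (x y : T) :
  (#|[set z : T | (x <= z < y)%O]| < m1)%N ->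
  (#|[set z : T | (x <= z < y)%O]| < m2)%N ->
  mobius_rec m1 x y = mobius_rec m2 x y.
Proof.
elim: m1 m2 y => [|m1 IH] [|m2] y //= h1 h2.
case: eqP => // _; case: ifP => // _; congr (- _)%R.
apply: eq_bigr => z /andP[xz zy].
have lt_card : (#|[set t : T | (x <= t < z)%O]| <
                #|[set t : T | (x <= t < y)%O]|)%N.
  apply: proper_card; apply/properP; split.
    apply/subsetP => t; rewrite !inE => /andP[-> tz] /=.
    exact: lt_trans tz zy.
  by exists z; rewrite !inE ?xz ?zy ?ltxx ?andbF.
by apply: IH; apply: leq_trans lt_card _; rewrite -ltnS.
Qed.

Lemma mobiusE d (T : finPOrderType d) (x y : T) :
  mobius x y =
    if x == y then 1%R
    else if x < y then (- \sum_(z : T | (x <= z < y)%O) mobius x z)%R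
    else 0%R.
Proof.
have below (z : T) : (#|[set t : T | (x <= t < z)%O]| < #|T|)%N.
  rewrite -cardsT; apply: proper_card; apply/properP; split.
    exact: subsetT.
  by exists z; rewrite !inE ?ltxx ?andbF.
rewrite /mobius (@mobius_rec_stable _ _ _ #|T|.+1) //=; exact: leqW.
Qed.

Definition Bell (m : nat) : nat :=
  #|[set P : {set {set 'I_m}} | partition P [set: 'I_m]]|.

(* The symbol l is [None], an element x of X is [Some x]. *)
Definition lblock (T : finType) (B : {set T}) (b : bool) : {set option T} :=
  (Some @: B) :|: (if b then [set None] else set0).

Definition is_lpart (T : finType) (pi : {set {set option T}}) : bool :=
  [exists P : {set {set T}}, exists L : {ffun {set T} -> bool},
     partition P [set: T] && (pi == [set lblock B (L B) | B in P])].

Record lpart (T : finType) := LPart {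
  blocks :> {set {set option T}};
  blocksP : is_lpart blocks
}.

HB.instance Definition _ (T : finType) := [isSub for @blocks T].
HB.instance Definition _ (T : finType) := [Finite of lpart T by <:].

Definition lpart_le (T : finType) (sigma pi : lpart T) : bool :=
  [forall B in blocks sigma, exists C in blocks pi, B \subset C].

Lemma lpart_le_refl (T : finType) : reflexive (@lpart_le T).
Proof. by move=> pi; apply/forall_inP => B hB; apply/exists_inP; exists B. Qed.

Lemma lpart_le_trans (T : finType) : transitive (@lpart_le T).
Proof.
move=> b a c /forall_inP hab /forall_inP hbc; apply/forall_inP => B hB.
have /exists_inP[C hC BC] := hab _ hB.
have /exists_inP[D hD CD] := hbc _ hC.
by apply/exists_inP; exists D => //; apply: subset_trans BC CD.
Qed.

Lemma Some_in_lblock (T : finType) (B : {set T}) (b : bool) (x : T) :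
  (Some x \in lblock B b) = (x \in B).
Proof.
by rewrite inE mem_imset; [case: b; rewrite !inE orbF | move=> ? ? []].
Qed.

Lemma lpart_block_has (T : finType) (pi : lpart T) (B : {set option T}) :
  B \in blocks pi -> exists x, Some x \in B.
Proof.
case: pi => pi /= /existsP[P /existsP[L /andP[hP /eqP ->]]].
case/imsetP => B0 hB0 ->.
have /set0Pn[x xB] := partition_neq0 hP hB0.
by exists x; rewrite Some_in_lblock.
Qed.

Lemma lpart_block_inj (T : finType) (pi : lpart T) (B C : {set option T}) x :
  B \in blocks pi -> C \in blocks pi -> Some x \in B -> Some x \in C -> B = C.
Proof.
case: pi => pi /= /existsP[P /existsP[L /andP[hP /eqP ->]]].
case/imsetP => B0 hB0 -> /imsetP[C0 hC0 ->]; rewrite !Some_in_lblock => xB xC.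
have tP := partition_trivIset hP.
by rewrite -(def_pblock tP hB0 xB) (def_pblock tP hC0 xC).
Qed.

Lemma lpart_le_anti (T : finType) : antisymmetric (@lpart_le T).
Proof.
have sub (a b : lpart T) : lpart_le a b -> lpart_le b a ->
    blocks a \subset blocks b.
  move=> /forall_inP hab /forall_inP hba; apply/subsetP => B hB.
  have /exists_inP[C hC BC] := hab _ hB.
  have /exists_inP[D hD CD] := hba _ hC.
  have [x xB] := lpart_block_has hB.
  have BD : B = D.
    exact: lpart_block_inj hB hD xB (subsetP CD _ (subsetP BC _ xB)).
  have -> : B = C by apply/eqP; rewrite eqEsubset BC BD CD.
  exact: hC.
move=> a b /andP[hab hba]; apply: val_inj; apply/eqP.
by rewrite eqEsubset !sub.
Qed.

Fact lpart_display : Order.disp_t. Proof. exact: (Order.Disp tt tt). Qed.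

HB.instance Definition _ (T : finType) :=
  Order.Le_isPOrder.Build lpart_display (lpart T)
    (@lpart_le_refl T) (@lpart_le_anti T) (@lpart_le_trans T).

Definition nlabelled (T : finType) (pi : lpart T) : nat :=
  #|[set B in blocks pi | None \in B]|.

Definition into_singletons (T : finType) (pi : lpart T) : bool :=
  [forall B in blocks pi, #|[set x : T | Some x \in B]| == 1%N].

Definition upper (T : finType) (piX : lpart T) : {set lpart T} :=
  [set pi : lpart T | (piX <= pi) && (0 < nlabelled pi)%N].

Definition mlab (T : finType) (pi : lpart T) : int := (nlabelled pi == 1%N)%:R%R.

Definition lambda (T : finType) (piX pi : lpart T) : int :=
  (\sum_(sigma in upper piX | (pi <= sigma)%O) mobius pi sigma * mlab sigma)%R.

Definition P0 (T : finType) (piX : lpart T) : nat :=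
  #|[set pi in upper piX | lambda piX pi != 0%R]|.

(* Main.v *)
(* Let pi have m >= 1 labelled and u unlabelled blocks.  Then lambda(pi) is
   (-1)^(m-1) (m-1)! if u <= 1, and 0 otherwise.  By Moebius inversion it is
   enough that, for every sigma with m >= 1, these values sum to [m = 1] over
   all tau >= sigma.  A tau >= sigma with at most one unlabelled block amounts
   to a set S of unlabelled blocks of sigma (merged into the unlabelled block
   of tau) and a partition Q of the remaining blocks of sigma, with |Q| labelled
   blocks in tau; and the sum of (-1)^(|Q|-1) (|Q|-1)! over the partitions Q of
   a nonempty set D is [|D| = 1].  So S contributes only if it misses exactly
   one block of sigma, i.e., if m = 1 and S is the set of all unlabelled blocks.
   The same encoding, applied to sigma = pi_X, counts the pi with
   lambda(pi) <> 0: a set S of j of the n - k unlabelled singletons, S not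
   everything, leaves Bell(n - j) choices for Q. *)

Require Import Defs.
From mathcomp Require Import all_boot all_order all_algebra.

Set Implicit Arguments.
Unset Strict Implicit.
Unset Printing Implicit Defensive.

Import Order.TTheory GRing.Theory Num.Theory.

(** * Sums over set partitions *)

Section BigPartition.

Variables (R : Type) (idx : R) (op : Monoid.com_law idx) (T : finType).
Implicit Types (A q : {set T}) (P Q : {set {set T}}) (F : nat -> R).

(** Removing [q] from [Q] and putting it back are inverse bijections. A general [op] serves both
    counts and signed sums. *)
Lemma big_partition_block A q F :
  q != set0 -> q \subset A ->
  \big[op/idx]_(Q | partition Q A && (q \in Q)) F #|Q| =
  \big[op/idx]_(Q | partition Q (A :\: q)) F #|Q|.+1.
Proof.
move=> q0 qA.
rewrite (reindex_onto (fun Q => q |: Q) (fun Q => Q :\ q)) /=; last first.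
  by move=> Q /andP[_ qQ]; rewrite setD1K.
have qnotin Q : partition Q (A :\: q) -> q \notin Q.
  move=> hQ; have [x xq] := set0Pn _ q0; apply/negP => qQ.
  have: x \in cover Q by apply/bigcupP; exists q.
  by rewrite (cover_partition hQ) inE xq.
apply: eq_big => [Q|Q /andP[/andP[hQ _] /eqP eQ]]; last first.
  by rewrite cardsU1 -[in q \in Q]eQ setD11.
rewrite setU11 andbT; apply/andP/idP => [[hQ /eqP eQ]|hQ].
  by rewrite -eQ; apply: partitionD1 => //; exact: setU11.
split; last by rewrite setU1K ?qnotin.
rewrite -[A in partition _ A](setID A q) (setIidPr qA).
apply: partitionU1 => //.
by rewrite -setI_eq0 setIDA [q :&: A]setIC (setIidPr qA) setDv.
Qed.

(** Partitions are sorted by the block containing [a]: [B] is the complement of that block, and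
    [.+1] accounts for the block itself. *)
Lemma big_partition_point A a F :
  a \in A ->
  \big[op/idx]_(Q | partition Q A) F #|Q| =
  \big[op/idx]_(B : {set T} | B \subset A :\ a)
    \big[op/idx]_(Q | partition Q B) F #|Q|.+1.
Proof.
move=> aA.
rewrite (partition_big (fun Q => pblock Q a)
   (fun q => (a \in q) && (q \subset A))) /=; last first.
  move=> Q hQ; have aQ : a \in cover Q by rewrite (cover_partition hQ).
  rewrite mem_pblock aQ /= -(cover_partition hQ).
  by apply: (bigcup_sup (pblock Q a)); apply: pblock_mem.
rewrite (reindex_onto (fun B => A :\: B) (fun q => A :\: q)) /=; last first.
  by move=> q /andP[_ qA]; rewrite setDDr setDv set0U (setIidPr qA).
apply: eq_big => [B|B /andP[/andP[aB _] /eqP eB]].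
  rewrite subsetDl andbT inE aA andbT subsetD1.
  rewrite setDDr setDv set0U [B \subset A](sameP setIidPr eqP) andbC.
  by [].
rewrite -[in RHS]eB -big_partition_block ?subsetDl //; last first.
  by apply/set0Pn; exists a.
apply: eq_bigl => Q; apply: andb_id2l => hQ; have tQ := partition_trivIset hQ.
apply/eqP/idP => [<-|qQ]; last exact: def_pblock qQ aB.
by apply: pblock_mem; rewrite (cover_partition hQ).
Qed.

End BigPartition.

Lemma sum_subset_card (V : nmodType) (T : finType) (A : {set T})
    (h : nat -> V) :
  (\sum_(B : {set T} | B \subset A) h #|B| =
   \sum_(0 <= j < #|A|.+1) h j *+ 'C(#|A|, j))%R.
Proof.
rewrite big_mkord.
(* [inord] never falls back on its default, as [B \subset A] bounds [#|B|]. *)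
rewrite (partition_big (fun B : {set T} => inord #|B| : 'I_#|A|.+1) predT) //=.
apply: eq_bigr => j _; rewrite -cards_draws -sumr_const.
have e (B : {set T}) :
    (B \subset A) && (inord #|B| == j) = (B \subset A) && (#|B| == j).
  apply: andb_id2l => BA; rewrite -val_eqE /= inordK // ltnS.
  exact: subset_leq_card.
rewrite (eq_bigl _ _ e); apply: eq_big => [B|B /andP[_ /eqP->//]].
by rewrite inE.
Qed.

Lemma sum_subset_card_nat (T : finType) (A : {set T}) (h : nat -> nat) :
  \sum_(B : {set T} | B \subset A) h #|B| =
  \sum_(0 <= j < #|A|.+1) 'C(#|A|, j) * h j.
Proof.
rewrite (@sum_subset_card nat); apply: eq_bigr => j _.
by rewrite -mulr_natl natn.
Qed.

(** The binomial expansion of [(1 - 1) ^+ #|A|]. *)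
Lemma sum_subset_sign (T : finType) (A : {set T}) :
  (\sum_(B : {set T} | B \subset A) (-1) ^+ #|B| = (A == set0)%:R :> int)%R.
Proof.
rewrite (@sum_subset_card _ _ A (fun j => (-1) ^+ j)%R) big_mkord.
have := @exprBn int 1 1 #|A|; rewrite subrr expr0n cards_eq0 => ->.
by apply: eq_bigr => j _; rewrite !expr1n !mulr1.
Qed.

Lemma sum_subset_compl (R : Type) (idx : R) (op : Monoid.com_law idx)
    (T : finType) (A : {set T}) (F : {set T} -> R) :
  \big[op/idx]_(B : {set T} | B \subset A) F (A :\: B) =
  \big[op/idx]_(B : {set T} | B \subset A) F B.
Proof.
rewrite [RHS](reindex_onto (fun B => A :\: B) (fun B => A :\: B)) /=.
  apply: eq_bigl => B.
  by rewrite subsetDl /= setDDr setDv set0U (sameP setIidPr eqP).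
by move=> B BA; rewrite setDDr setDv set0U (setIidPr BA).
Qed.

(** * Bell numbers *)

Lemma Bell0 : Bell 0 = 1.
Proof.
rewrite /Bell (_ : [set: 'I_0] = set0); last by apply/setP => -[].
rewrite -(cards1 (set0 : {set {set 'I_0}})); apply: eq_card => Q.
by rewrite !inE partition_set0.
Qed.

(** Fixing a point gives the same recursion for [A] and for [[set: 'I_#|A|]], so strong induction on
    the size identifies the two counts. *)
Lemma card_partitions (T : finType) (A : {set T}) :
  #|[set Q | partition Q A]| = Bell #|A|.
Proof.
have [m] := ubnP #|A|; elim: m T A => // m IH T A.
have rec (T' : finType) (D : {set T'}) : #|D| <= m -> D != set0 ->
    #|[set Q | partition Q D]| =
    \sum_(0 <= j < #|D|.-1.+1) 'C(#|D|.-1, j) * Bell j.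
  move=> leD /set0Pn[a aD]; rewrite -sum1dep_card.
  rewrite (big_partition_point _ (fun _ => 1) aD).
  have -> : #|D|.-1 = #|D :\ a| by rewrite [in LHS](cardsD1 a) aD.
  rewrite -sum_subset_card_nat; apply: eq_bigr => B BD.
  rewrite sum1dep_card; apply: IH.
  apply: leq_ltn_trans (subset_leq_card BD) _.
  by apply: leq_trans leD; rewrite [leqRHS](cardsD1 a) aD.
rewrite ltnS => leA; have [->|A0] := eqVneq A set0.
  rewrite cards0 Bell0 -(cards1 (set0 : {set {set T}})).
  by apply: eq_card => Q; rewrite !inE partition_set0.
have cI : #|[set: 'I_#|A|]| = #|A| by rewrite cardsT card_ord.
rewrite (rec _ _ leA A0) /Bell rec ?cI //.
by rewrite -cards_eq0 cI cards_eq0.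
Qed.

Lemma Bell_rec n : Bell n.+1 = \sum_(0 <= j < n.+1) 'C(n, j) * Bell j.
Proof.
have a0 : ord0 \in [set: 'I_n.+1] by rewrite inE.
rewrite /Bell -sum1dep_card (big_partition_point _ (fun _ => 1) a0).
have cn : #|[set: 'I_n.+1] :\ ord0| = n.
  by have := cardsD1 ord0 [set: 'I_n.+1]; rewrite a0 cardsT card_ord => -[].
have := sum_subset_card_nat ([set: 'I_n.+1] :\ ord0) Bell.
rewrite cn => <-; apply: eq_bigr => B _.
by rewrite sum1dep_card card_partitions.
Qed.

(** In exponential generating functions: 1 / (1 + (e^x - 1)) = e^(-x). *)
Lemma sum_partition_fact (T : finType) (A : {set T}) :
  (\sum_(Q | partition Q A) (-1) ^+ #|Q| * #|Q|`!%:R = (-1) ^+ #|A| :> int)%R.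
Proof.
have [m] := ubnP #|A|; elim: m A => // m IH A; rewrite ltnS => leA.
have [->|A0] := eqVneq A set0.
  rewrite (eq_bigl (pred1 set0)) => [|Q]; last by rewrite partition_set0.
  by rewrite big_pred1_eq !cards0 mulr1.
(* As |Q|! = |Q| (|Q|-1)!, this is a sum over pairs of a partition [Q] and a
   block [q] of [Q]; summing over [q] first gives the recursion. *)
transitivity (\sum_(Q | partition Q A)
    \sum_(q in Q) (-1) ^+ #|Q| * #|Q|.-1`!%:R : int)%R.
  apply: eq_bigr => Q hQ; rewrite sumr_const.
  have : 0 < #|Q|.
    rewrite card_gt0; apply: contraNneq A0 => Q0.
    by rewrite -(cover_partition hQ) Q0 /cover big_set0.
  by case: #|Q| => // j _; rewrite factS natrM mulrCA mulr_natl.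
rewrite (exchange_big_dep (fun q => (q != set0) && (q \subset A))) /=; last first.
  move=> Q q hQ qQ; rewrite (partition_neq0 hQ qQ) -(cover_partition hQ).
  exact: (bigcup_sup q).
have neg q : (q != set0) && (q \subset A) ->
    (\sum_(Q | partition Q A && (q \in Q)) (-1) ^+ #|Q| * #|Q|.-1`!%:R =
     - (-1) ^+ #|A :\: q| :> int)%R.
  case/andP=> q0 qA.
  rewrite (big_partition_block _ (fun j => (-1) ^+ j * j.-1`!%:R)%R q0 qA).
  rewrite -IH -?sumrN.
    by apply: eq_bigr => Q _; rewrite exprS mulN1r mulNr.
  apply: leq_trans leA; rewrite -card_gt0 in q0.
  by rewrite cardsD (setIidPr qA) ltn_subrL q0 (leq_trans q0) ?subset_leq_card.
(* The signs [(-1) ^+ #|A :\: q|] over all [q \subset A] cancel, so those with [q] nonempty sum to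
   minus the term at [set0], which is [(-1) ^+ #|A|]. *)
rewrite (eq_bigr _ neg) sumrN.
have := sum_subset_sign A; rewrite (negPf A0).
rewrite -(sum_subset_compl _ _ (fun B => (-1) ^+ #|B|)%R).
rewrite (bigD1 set0) ?sub0set //= setD0.
rewrite (eq_bigl (fun q => (q != set0) && (q \subset A))) => [/eqP|q].
  by rewrite addr_eq0 => /eqP->.
by rewrite andbC.
Qed.

(* Only meaningful for [0 < j]: [signed_fact 0] is the junk value 1. *)
Definition signed_fact (j : nat) : int := ((-1) ^+ j.-1 * (j.-1)`!%:R)%R.

Lemma signed_fact_neq0 j : signed_fact j != 0%R.
Proof.
by rewrite mulf_neq0 ?signr_eq0 // pnatr_eq0 -lt0n fact_gt0.
Qed.

(** [signed_fact #|Q|] is the Moebius value from [Q] to the one-block partition. Fixing a point [a]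
    turns the inner sums into signs [(-1) ^+ #|B|], which cancel unless [A :\ a] is empty. *)
Lemma sum_partition_signed_fact (T : finType) (A : {set T}) :
  A != set0 ->
  (\sum_(Q | partition Q A) signed_fact #|Q| = (#|A| == 1%N)%:R)%R.
Proof.
move=> /set0Pn[a aA]; rewrite (big_partition_point _ signed_fact aA).
under eq_bigr => B _ do rewrite sum_partition_fact.
by rewrite sum_subset_sign (cardsD1 a) aA -cards_eq0 eqSS.
Qed.

(** * Coarsenings with at most one unlabelled block *)

Lemma lpart_cover (X : finType) (pi : lpart X) x :
  exists2 B, B \in blocks pi & Some x \in B.
Proof.
case: pi => pi /= /existsP[P /existsP[L /andP[hP /eqP->]]].
have : x \in cover P by rewrite (cover_partition hP) inE.
case/bigcupP=> B BP xB; exists (lblock B (L B)); last by rewrite Some_in_lblock.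
exact: imset_f.
Qed.

(** The traces [Some @^-1: B] form the underlying partition; a trace counts as labelled when its
    copy with [None] belongs to [pi]. *)
Lemma is_lpart_intro (X : finType) (pi : {set {set option X}}) :
  (forall B, B \in pi -> exists x, Some x \in B) ->
  (forall x, exists2 B, B \in pi & Some x \in B) ->
  (forall B C x, B \in pi -> C \in pi -> Some x \in B -> Some x \in C ->
     B = C) ->
  is_lpart pi.
Proof.
move=> pi_has pi_cover pi_inj; pose r (B : {set option X}) := Some @^-1: B.
apply/existsP; exists (r @: pi).
apply/existsP; exists [ffun A : {set X} => (None |: Some @: A) \in pi].
have rK B : B \in pi -> lblock (r B) ((None |: Some @: r B) \in pi) = B.
  move=> Bpi; have [x xB] := pi_has _ Bpi.
  have someE y : (Some y \in Some @: r B) = (Some y \in B).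
    by rewrite mem_imset ?inE //; move=> ? ? [].
  have noneE : (None \in Some @: r B) = false by apply/imsetP=> -[].
  rewrite /lblock; case: ifP => h.
    rewrite setUC; apply: (pi_inj _ _ _ h Bpi _ xB).
    by rewrite inE someE xB orbT.
  rewrite setU0; apply/setP => -[y|]; rewrite ?someE // noneE.
  (* If [None] were in [B], then [B] would be the labelled copy of its trace, which [h] keeps out of
     [pi]. *)
  apply/esym/negP => nB; case/negP: (negbT h).
  suff -> : None |: Some @: r B = B by [].
  by apply/setP => -[y|]; rewrite in_setU1 ?someE.
apply/andP; split; last first.
  rewrite eqEsubset; apply/andP; split; apply/subsetP => B.
    move=> Bpi; apply/imsetP; exists (r B); first exact: imset_f.
    by rewrite ffunE rK.
  by case/imsetP=> A /imsetP[C Cpi ->] ->; rewrite ffunE rK.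
apply/and3P; split.
- rewrite eqEsubset subsetT; apply/subsetP => x _.
  have [B Bpi xB] := pi_cover x; apply/bigcupP; exists (r B); last by rewrite inE.
  exact: imset_f.
- apply/trivIsetP => A1 A2 /imsetP[B1 B1pi ->] /imsetP[B2 B2pi ->] ne.
  rewrite -setI_eq0; apply: contraNT ne => /set0Pn[x]; rewrite !inE.
  by case/andP=> x1 x2; rewrite (pi_inj _ _ _ B1pi B2pi x1 x2).
- apply/imsetP => -[B Bpi /esym/setP B0]; have [x xB] := pi_has _ Bpi.
  by have := B0 x; rewrite !inE xB.
Qed.

Definition unlab (X : finType) (pi : lpart X) : {set {set option X}} :=
  [set B in blocks pi | None \notin B].

Lemma lpart_leE (X : finType) (sigma tau : lpart X) :
  (sigma <= tau)%O = lpart_le sigma tau.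
Proof. by []. Qed.

Section Coarsening.

Variables (X : finType) (sigma : lpart X).
Local Notation bl := {set {set option X}}.
Implicit Types (tau : lpart X) (S q : bl) (Q : {set bl}) (B C : {set option X}).

Lemma in_cover_blocks q B x :
  q \subset blocks sigma -> B \in blocks sigma -> Some x \in B ->
  (Some x \in cover q) = (B \in q).
Proof.
move=> /subsetP qs Bs xB; apply/bigcupP/idP => [[C Cq xC]|Bq]; last by exists B.
by rewrite (lpart_block_inj Bs (qs _ Cq) xB xC).
Qed.

(** Blocks of [sigma] are disjoint on [X] and each meets [X], so a family of blocks can be read off
    from its union. *)
Lemma sub_cover_blocks q B :
  q \subset blocks sigma -> B \in blocks sigma ->
  (B \subset cover q) = (B \in q).
Proof.
move=> qs Bs; apply/idP/idP => [/subsetP h|Bq]; last exact: (bigcup_sup B).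
have [x xB] := lpart_block_has Bs.
by rewrite -(in_cover_blocks qs Bs xB) h.
Qed.

Lemma sub_lcover_blocks q B :
  q \subset blocks sigma -> B \in blocks sigma ->
  (B \subset None |: cover q) = (B \in q).
Proof.
move=> qs Bs; apply/idP/idP => [/subsetP h|Bq].
  have [x xB] := lpart_block_has Bs.
  by have := h _ xB; rewrite in_setU1 /= (in_cover_blocks qs Bs xB).
by apply: subset_trans (subsetUr _ _); exact: (bigcup_sup B).
Qed.

Lemma le_block_sub tau B C x :
  (sigma <= tau)%O -> B \in blocks sigma -> C \in blocks tau ->
  Some x \in B -> Some x \in C -> B \subset C.
Proof.
rewrite lpart_leE => /forall_inP le Bs Ct xB xC.
have /exists_inP[D Dt BD] := le _ Bs.
by rewrite (lpart_block_inj Ct Dt xC (subsetP BD _ xB)).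
Qed.

Lemma block_sub_inj tau B C D :
  B \in blocks sigma -> C \in blocks tau -> D \in blocks tau ->
  B \subset C -> B \subset D -> C = D.
Proof.
move=> Bs Ct Dt /subsetP BC /subsetP BD; have [x xB] := lpart_block_has Bs.
exact: lpart_block_inj Ct Dt (BC _ xB) (BD _ xB).
Qed.

(* A coarsening of [sigma] with at most one unlabelled block is encoded by the
   set [p.1] of blocks of [sigma] merged into that unlabelled block ([set0] if
   there is none) and the partition [p.2] of the other blocks of [sigma] into
   the labelled blocks. *)
Definition merging (p : bl * {set bl}) : bool :=
  (p.1 \subset unlab sigma) && partition p.2 (blocks sigma :\: p.1).

(** Deleting [set0] discards [cover p.1] when [p.1] is empty; the labelled blocks contain [None] and
    stay. *)
Definition merge_blocks (p : bl * {set bl}) : bl :=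
  (cover p.1 |: [set None |: cover q | q : bl in p.2]) :\ set0.

Definition merge (p : bl * {set bl}) : lpart X :=
  insubd sigma (merge_blocks p).

Definition unmerge tau : bl * {set bl} :=
  ([set B in blocks sigma | [exists C in unlab tau, B \subset C]],
   [set [set B in blocks sigma | B \subset C] |
     C : {set option X} in blocks tau :\: unlab tau]).

(** * From an encoding to the coarsening *)

Section Merging.

Variables (S : bl) (Q : {set bl}).
Hypothesis SQ : merging (S, Q).

Let S_unlab : S \subset unlab sigma. Proof. by case/andP: SQ. Qed.

Let S_sub : S \subset blocks sigma.
Proof.
by apply: subset_trans S_unlab _; apply/subsetP => B; rewrite inE => /andP[].
Qed.

Let hQ : partition Q (blocks sigma :\: S). Proof. by case/andP: SQ. Qed.

Let Q_sub q : q \in Q -> q \subset blocks sigma.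
Proof.
move=> qQ; apply: subset_trans (subsetDl _ S).
by rewrite -(cover_partition hQ); exact: (bigcup_sup q).
Qed.

Let Q_notin_S q B : q \in Q -> B \in q -> B \notin S.
Proof.
move=> qQ Bq; have : B \in cover Q by apply/bigcupP; exists q.
by rewrite (cover_partition hQ) inE => /andP[].
Qed.

Let Q_inj q q' B : q \in Q -> q' \in Q -> B \in q -> B \in q' -> q = q'.
Proof.
move=> qQ qQ' Bq Bq'; have tQ := partition_trivIset hQ.
by rewrite -(def_pblock tQ qQ Bq) (def_pblock tQ qQ' Bq').
Qed.

Let none_cover : None \notin cover S.
Proof.
apply/bigcupP => -[B BS nB]; have := subsetP S_unlab _ BS.
by rewrite inE nB andbF.
Qed.

Let merge_blocksP C : C \in merge_blocks (S, Q) ->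
  (C = cover S /\ C != set0) \/ exists2 q, q \in Q & C = None |: cover q.
Proof.
rewrite in_setD1 in_setU1 => /andP[C0 /orP[/eqP CS|/imsetP[q qQ ->]]].
  by left.
by right; exists q.
Qed.

Let mem_cover_S B : B \in S -> cover S \in merge_blocks (S, Q).
Proof.
move=> BS; rewrite in_setD1 setU11 andbT.
have [x xB] := lpart_block_has (subsetP S_sub _ BS).
by apply/set0Pn; exists (Some x); apply/bigcupP; exists B.
Qed.

Let mem_cover_Q q : q \in Q -> None |: cover q \in merge_blocks (S, Q).
Proof.
move=> qQ; rewrite in_setD1 in_setU1 (imset_f (fun q => None |: cover q)) //.
by rewrite orbT andbT; apply/set0Pn; exists None; rewrite setU11.
Qed.

Let block_dec B : B \in blocks sigma -> B \in S \/ exists2 q, q \in Q & B \in q.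
Proof.
move=> Bs; have [|BS] := boolP (B \in S); first by left.
have : B \in cover Q by rewrite (cover_partition hQ) inE BS.
by case/bigcupP => q; right; exists q.
Qed.

(** Every block of [sigma] lies either in [S] or in a single member of [Q], so each point of [X]
    falls in exactly one union. *)
Lemma merge_is_lpart : is_lpart (merge_blocks (S, Q)).
Proof.
apply: is_lpart_intro => [C /merge_blocksP[[-> /set0Pn[y /bigcupP[B BS _]]]|]|x|].
- have [x xB] := lpart_block_has (subsetP S_sub _ BS).
  by exists x; apply/bigcupP; exists B.
- case=> q qQ ->; have /set0Pn[B Bq] := partition_neq0 hQ qQ.
  have [x xB] := lpart_block_has (subsetP (Q_sub qQ) _ Bq).
  by exists x; rewrite inE; apply/orP; right; apply/bigcupP; exists B.
- have [B Bs xB] := lpart_cover sigma x.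
  case: (block_dec Bs) => [BS|[q qQ Bq]].
    exists (cover S); first exact: mem_cover_S BS.
    by apply/bigcupP; exists B.
  exists (None |: cover q); first exact: mem_cover_Q.
  by rewrite inE; apply/orP; right; apply/bigcupP; exists B.
move=> C D x hC hD xC xD; have [B Bs xB] := lpart_cover sigma x.
case: (merge_blocksP hC) (merge_blocksP hD) xC xD.
  case=> -> _ [[-> _] //|[q qQ ->]]; rewrite in_setU1 /=.
  rewrite (in_cover_blocks S_sub Bs xB) (in_cover_blocks (Q_sub qQ) Bs xB).
  by move=> BS Bq; have := Q_notin_S qQ Bq; rewrite BS.
case=> q qQ -> [[-> _]|[q' qQ' ->]]; rewrite !in_setU1 /=.
  rewrite (in_cover_blocks S_sub Bs xB) (in_cover_blocks (Q_sub qQ) Bs xB).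
  by move=> Bq BS; have := Q_notin_S qQ Bq; rewrite BS.
rewrite !(in_cover_blocks _ Bs xB) ?Q_sub // => Bq Bq'.
by rewrite (Q_inj qQ qQ' Bq Bq').
Qed.

Lemma merge_blocksE : blocks (merge (S, Q)) = merge_blocks (S, Q).
Proof. exact: (insubdK sigma merge_is_lpart). Qed.

Lemma le_merge : (sigma <= merge (S, Q))%O.
Proof.
rewrite lpart_leE; apply/forall_inP => B Bs; apply/exists_inP.
rewrite merge_blocksE; case: (block_dec Bs) => [BS|[q qQ Bq]].
  by exists (cover S); rewrite ?(mem_cover_S BS) ?sub_cover_blocks.
by exists (None |: cover q); rewrite ?mem_cover_Q ?sub_lcover_blocks ?Q_sub.
Qed.

Lemma unlab_merge :
  unlab (merge (S, Q)) = [set cover S] :\ set0.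
Proof.
apply/setP => C; rewrite !inE merge_blocksE; apply/andP/andP.
  case=> /merge_blocksP[[-> C0]|[q _ ->]]; first by rewrite C0 eqxx.
  by rewrite setU11.
by case=> C0 /eqP CS; rewrite CS none_cover in_setD1 setU11 -CS C0.
Qed.

Lemma lab_merge :
  blocks (merge (S, Q)) :\: unlab (merge (S, Q)) =
  [set None |: cover q | q : bl in Q].
Proof.
apply/setP => C; rewrite in_setD !inE merge_blocksE.
apply/andP/imsetP => [[]|[q qQ ->]]; last first.
  by rewrite mem_cover_Q // setU11 andbF.
move=> + hC; rewrite hC /= negbK => nC.
case: (merge_blocksP hC) nC => [[-> _]|//].
by rewrite (negPf none_cover).
Qed.

Lemma mergeK : unmerge (merge (S, Q)) = (S, Q).
Proof.
congr pair; last first.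
  rewrite lab_merge -imset_comp -[RHS]imset_id; apply: eq_in_imset => q qQ.
  apply/setP => B; rewrite !inE; apply/andP/idP => [[Bs]|Bq].
    by rewrite sub_lcover_blocks ?Q_sub.
  have Bs := subsetP (Q_sub qQ) _ Bq.
  by rewrite sub_lcover_blocks ?Q_sub.
apply/setP => B; rewrite inE unlab_merge; apply/andP/idP => [[Bs]|BS].
  case/exists_inP => C; rewrite !inE => /andP[_ /eqP->].
  by rewrite sub_cover_blocks.
have Bs := subsetP S_sub _ BS; split=> //; apply/exists_inP; exists (cover S).
  by have := mem_cover_S BS; rewrite !inE eqxx => /andP[->].
by rewrite sub_cover_blocks.
Qed.

Lemma nlabelled_merge : nlabelled (merge (S, Q)) = #|Q|.
Proof.
have -> : nlabelled (merge (S, Q)) =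
    #|blocks (merge (S, Q)) :\: unlab (merge (S, Q))|.
  apply: eq_card => B; rewrite !inE; case: (B \in blocks _) => //=.
  by rewrite negbK andbT.
rewrite lab_merge card_in_imset // => q q' qQ qQ' /= e; apply/setP => B.
have [Bs|] := boolP (B \in blocks sigma).
  by rewrite -(sub_lcover_blocks (Q_sub qQ) Bs) e sub_lcover_blocks ?Q_sub.
by move=> Bs; apply/idP/idP => /(subsetP (Q_sub _)) h; case/negP: Bs; apply: h.
Qed.

End Merging.

(** * From a coarsening to its encoding *)

Section Unmerging.

Variable tau : lpart X.
Hypotheses (le_tau : (sigma <= tau)%O) (unlab1 : #|unlab tau| <= 1).

Let block_up B : B \in blocks sigma -> exists2 C, C \in blocks tau & B \subset C.
Proof.
by move: le_tau; rewrite lpart_leE => /forall_inP h /h/exists_inP[C]; exists C.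
Qed.

Let block_down C : C \in blocks tau ->
  exists B, [/\ B \in blocks sigma & B \subset C].
Proof.
move=> Ct; have [x xC] := lpart_block_has Ct; have [B Bs xB] := lpart_cover sigma x.
by exists B; split=> //; apply: le_block_sub Ct xB xC.
Qed.

Let labE C : (C \in blocks tau :\: unlab tau) = (C \in blocks tau) && (None \in C).
Proof.
by rewrite !inE; case: (C \in blocks tau); rewrite ?andbF //= andbT negbK.
Qed.

Lemma merging_unmerge : merging (unmerge tau).
Proof.
apply/andP; split=> /=.
  apply/subsetP => B; rewrite !inE => /andP[-> /exists_inP[C]] /=.
  rewrite inE => /andP[_ nC] /subsetP BC.
  by apply: contra nC; exact: BC.
apply/and3P; split.
- rewrite eqEsubset; apply/andP; split; apply/subsetP => B.
    case/bigcupP => q /imsetP[C]; rewrite labE => /andP[Ct nC] ->.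
    rewrite !inE => /andP[Bs BC]; rewrite Bs andbT /=.
    apply/exists_inP => -[D]; rewrite inE => /andP[Dt nD] BD.
    by rewrite (block_sub_inj Bs Ct Dt BC BD) (negPf nD) in nC.
  rewrite !inE => /andP[+ Bs]; rewrite Bs /= => hB.
  have [C Ct BC] := block_up Bs; apply/bigcupP.
  exists [set B in blocks sigma | B \subset C]; last by rewrite inE Bs.
  apply: imset_f; rewrite labE Ct /=; apply: contraNT hB => nC.
  by apply/exists_inP; exists C; rewrite ?inE ?Ct.
- apply/trivIsetP => q q' /imsetP[C hC ->] /imsetP[D hD ->] ne.
  rewrite -setI_eq0; apply: contraNT ne => /set0Pn[B]; rewrite !inE.
  case/andP => /andP[Bs BC] /andP[_ BD]; apply/eqP.
  move: hC hD; rewrite !labE => /andP[Ct _] /andP[Dt _].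
  by rewrite (block_sub_inj Bs Ct Dt BC BD).
- apply/imsetP => -[C]; rewrite labE => /andP[Ct _] /esym/setP h.
  by have [B [Bs BC]] := block_down Ct; have := h B; rewrite !inE Bs BC.
Qed.

Let cover_up C x : C \in blocks tau ->
  (Some x \in cover [set B in blocks sigma | B \subset C]) = (Some x \in C).
Proof.
move=> Ct; apply/bigcupP/idP => [[B]|xC].
  by rewrite inE => /andP[_ /subsetP h] /h.
have [B Bs xB] := lpart_cover sigma x; exists B => //.
by rewrite inE Bs (le_block_sub le_tau Bs Ct xB xC).
Qed.

(** The blocks of [sigma] below [C] may all be unlabelled, so [None] has to be added to their
    union. *)
Let lcover_up C : C \in blocks tau -> None \in C ->
  None |: cover [set B in blocks sigma | B \subset C] = C.
Proof.
move=> Ct nC; apply/setP => -[x|]; last by rewrite setU11 nC.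
by rewrite in_setU1 /= cover_up.
Qed.

Let ucover_up C : C \in unlab tau -> cover (unmerge tau).1 = C.
Proof.
move=> Cu; have := Cu; rewrite inE => /andP[Ct nC].
have -> : (unmerge tau).1 = [set B in blocks sigma | B \subset C].
  apply/setP => B; rewrite !inE; apply: andb_id2l => _.
  apply/exists_inP/idP => [[D Du BD]|BC]; last by exists C.
  (* With at most one unlabelled block, [D] is [C]. *)
  by rewrite (card_le1_eqP unlab1 _ _ Du Cu).
apply/setP => -[x|]; first by rewrite cover_up.
rewrite (negPf nC); apply/bigcupP => -[B]; rewrite inE => /andP[_ /subsetP h] /h.
by rewrite (negPf nC).
Qed.

Lemma unmergeK : merge (unmerge tau) = tau.
Proof.
have := merging_unmerge; case E : (unmerge tau) => [S Q] SQ.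
apply: val_inj => /=; rewrite (merge_blocksE SQ).
have ES : S = (unmerge tau).1 by rewrite E.
have EQ : Q = (unmerge tau).2 by rewrite E.
apply/setP => C; rewrite in_setD1 in_setU1 /= ES EQ; apply/andP/idP.
  case=> C0 /orP[/eqP CS|/imsetP[q /imsetP[D]]].
    move: C0; rewrite CS => /set0Pn[y /bigcupP[B]]; rewrite inE.
    case/andP => _ /exists_inP[D Du _] _; rewrite (ucover_up Du).
    by move: Du; rewrite inE => /andP[].
  by rewrite labE => /andP[Dt nD] -> ->; rewrite lcover_up.
move=> Ct; split.
  by have [x xC] := lpart_block_has Ct; apply/set0Pn; exists (Some x).
have [nC|nC] := boolP (None \in C); apply/orP; [right|left].
  apply/imsetP; exists [set B in blocks sigma | B \subset C].
    by apply: imset_f; rewrite labE Ct.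
  by rewrite lcover_up.
by rewrite (@ucover_up C) // inE Ct.
Qed.

End Unmerging.

Lemma big_coarsening (R : Type) (idx : R) (op : Monoid.com_law idx)
    (F : nat -> R) :
  \big[op/idx]_(tau : lpart X | (sigma <= tau)%O && (#|unlab tau| <= 1))
     F (nlabelled tau) =
  \big[op/idx]_(S : bl | S \subset unlab sigma)
     \big[op/idx]_(Q | partition Q (blocks sigma :\: S)) F #|Q|.
Proof.
rewrite pair_big_dep /= (reindex_onto merge unmerge) /=; last first.
  by move=> tau /andP[le_tau u1]; exact: unmergeK.
apply: eq_big => [[S Q]|[S Q] /andP[/andP[le u1] /eqP e]] /=; last first.
  by have := merging_unmerge le; rewrite e => SQ; rewrite nlabelled_merge.
(* The pairs that [unmerge] recovers from an admissible coarsening are exactly the [merging]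
   pairs. *)
apply/andP/idP => [[/andP[le u1] /eqP e]|SQ].
  by have := merging_unmerge le; rewrite e.
rewrite le_merge // mergeK // unlab_merge //; split=> //=.
by rewrite -(cards1 (cover S)) subset_leq_card ?subD1set.
Qed.

End Coarsening.

(** * The values of lambda *)

(** For [x < y] the recursion makes the term at [y] cancel all the others. *)
Lemma sum_mobius d (T : finPOrderType d) (x y : T) :
  (\sum_(z : T | (x <= z <= y)%O) mobius x z = (x == y)%:R)%R.
Proof.
have [<-|ne] := eqVneq x y.
  rewrite (eq_bigl (pred1 x)) ?big_pred1_eq ?mobiusE ?eqxx // => z.
  by rewrite andbC -eq_le.
have [xy|nxy] := boolP (x <= y)%O; last first.
  rewrite big1 // => z /andP[xz zy]; case/negP: nxy; exact: le_trans xz zy.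
rewrite (bigD1 y) ?xy ?lexx //= mobiusE (negPf ne) lt_neqAle ne xy /=.
rewrite [X in (_ + X)%R](eq_bigl (fun z => (x <= z < y)%O)) ?addNr // => z.
by rewrite [(z < y)%O]lt_neqAle andbCA andbC.
Qed.

Section Lambda.

Variable X : finType.
Implicit Types pi sigma tau : lpart X.

Lemma unlab_sub pi : unlab pi \subset blocks pi.
Proof. by apply/subsetP => B; rewrite inE => /andP[]. Qed.

Lemma card_blocks pi : #|blocks pi| = nlabelled pi + #|unlab pi|.
Proof.
rewrite -(cardsID (unlab pi)) addnC (setIidPr (unlab_sub pi)); congr (_ + _).
apply: eq_card => B; rewrite !inE; case: (B \in blocks pi) => //=.
by rewrite andbT negbK.
Qed.

Lemma nlabelled_gt0_le sigma tau :
  (sigma <= tau)%O -> 0 < nlabelled sigma -> 0 < nlabelled tau.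
Proof.
rewrite lpart_leE => /forall_inP le /card_gt0P[B]; rewrite inE => /andP[Bs nB].
have /exists_inP[C Ct BC] := le _ Bs; apply/card_gt0P; exists C.
by rewrite inE Ct (subsetP BC).
Qed.

Definition lambda_val tau : int :=
  if #|unlab tau| <= 1 then signed_fact (nlabelled tau) else 0%R.

Lemma sum_lambda_val sigma :
  0 < nlabelled sigma ->
  (\sum_(tau : lpart X | (sigma <= tau)%O) lambda_val tau = mlab sigma)%R.
Proof.
move=> m0; rewrite -big_mkcondr big_coarsening.
have cardD (S : {set {set option X}}) : S \subset unlab sigma ->
    #|blocks sigma :\: S| = nlabelled sigma + (#|unlab sigma| - #|S|).
  move=> Su; rewrite cardsD (setIidPr (subset_trans Su (unlab_sub _))).
  by rewrite card_blocks addnBA // subset_leq_card.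
(* Labelled blocks of [sigma] are never in [S], so the set being partitioned is nonempty. *)
rewrite (eq_bigr (fun S => (#|blocks sigma :\: S| == 1%N)%:R%R)); last first.
  move=> S Su; rewrite sum_partition_signed_fact // -card_gt0 cardD //.
  by rewrite addn_gt0 m0.
(* The term [S = unlab sigma] is [mlab sigma]; any smaller [S] leaves at least two blocks. *)
rewrite (bigD1 (unlab sigma)) //= cardD // subnn addn0 big1 ?addr0 // => S.
case/andP=> Su ne; rewrite cardD //.
have lt : #|S| < #|unlab sigma| by rewrite proper_card // properEneq ne.
suff -> : (nlabelled sigma + (#|unlab sigma| - #|S|) == 1) = false by [].
by apply/negbTE; rewrite neq_ltn orbC -(addn1 1) leq_add // subn_gt0.
Qed.

Lemma lambdaE (piX pi : lpart X) :
  pi \in upper piX -> lambda piX pi = lambda_val pi.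
Proof.
rewrite inE => /andP[le_pi m0].
(* Coarsening preserves having a label, so everything above [pi] is in [upper piX]. *)
rewrite /lambda (eq_bigl (fun sigma => (pi <= sigma)%O)); last first.
  move=> sigma; rewrite inE andbC; apply: andb_idr => le.
  by rewrite (le_trans le_pi le) (nlabelled_gt0_le le m0).
rewrite (eq_bigr (fun sigma =>
    \sum_(tau : lpart X | (sigma <= tau)%O) mobius pi sigma * lambda_val tau)%R);
  last first.
  by move=> sigma le; rewrite -mulr_sumr sum_lambda_val // (nlabelled_gt0_le le).
(* The coefficient of [lambda_val tau] is now the sum of [mobius pi] over the interval from [pi] to
   [tau], zero unless [tau] is [pi]. *)
rewrite (exchange_big_dep predT) //= (bigD1 pi) //=.
rewrite -mulr_suml sum_mobius eqxx mul1r big1 ?addr0 // => tau ne.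
by rewrite -mulr_suml sum_mobius eq_sym (negPf ne) mul0r.
Qed.

(** The factor [j < #|blocks piX|] excludes merging all blocks into the unlabelled one, which would
    leave no label. *)
Lemma P0E (piX : lpart X) :
  P0 piX = \sum_(0 <= j < #|unlab piX|.+1)
    'C(#|unlab piX|, j) * ((j < #|blocks piX|) * Bell (#|blocks piX| - j)).
Proof.
rewrite -(sum_subset_card_nat _
  (fun j => (j < #|blocks piX|) * Bell (#|blocks piX| - j))).
transitivity (\sum_(tau : lpart X | (piX <= tau)%O && (#|unlab tau| <= 1))
    (0 < nlabelled tau : nat)).
  rewrite [RHS](eq_bigr (fun tau => if 0 < nlabelled tau then 1 else 0)); last first.
    by move=> tau _; case: (0 < _).
  rewrite -big_mkcondr /P0 -sum1dep_card; apply: eq_bigl => tau.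
  have [tau_up|] := boolP (tau \in upper piX); last first.
    by rewrite inE andbAC => /negPf->.
  rewrite lambdaE // /lambda_val; move: tau_up; rewrite inE => /andP[-> ->].
  by case: (#|_| <= 1); rewrite ?signed_fact_neq0 ?eqxx.
rewrite (big_coarsening _ _ (fun m => 0 < m : nat)); apply: eq_bigr => S Su.
have Sb := subset_trans Su (unlab_sub piX).
have cD : #|blocks piX :\: S| = #|blocks piX| - #|S|.
  by rewrite cardsD (setIidPr Sb).
rewrite /= -cD -card_partitions -sum1dep_card big_distrr /=; apply: eq_bigr => Q hQ.
rewrite muln1 -[#|S| < _]subn_gt0 -cD !card_gt0; congr (nat_of_bool (~~ _)).
apply/eqP/eqP => e; first by rewrite -(cover_partition hQ) e /cover big_set0.
by move: hQ; rewrite e partition_set0 => /eqP.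
Qed.

Lemma card_into_singletons pi : into_singletons pi -> #|blocks pi| = #|X|.
Proof.
move=> /forall_inP single; pose r (B : {set option X}) := [set x : X | Some x \in B].
rewrite -(card_in_imset (f := r)); last first.
  move=> B C Bpi Cpi /setP e; have [x xB] := lpart_block_has Bpi.
  by apply: (lpart_block_inj Bpi Cpi xB); have := e x; rewrite !inE xB.
rewrite -cardsT -(card_imset _ (@set1_inj X)); congr #|pred_of_set _|.
apply/setP => A; apply/imsetP/imsetP => [[B Bpi ->]|[x _ ->]].
  by have /cards1P[x e] := single _ Bpi; exists x.
have [B Bpi xB] := lpart_cover pi x; exists B => //.
have /cards1P[y e] := single _ Bpi; rewrite /r e.
have : x \in [set z | Some z \in B] by rewrite inE.
by rewrite e inE => /eqP->.
Qed.

End Lambda.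

Theorem theorem6p12 (X : finType) (n k : nat) (piX : lpart X) :
  #|X| = n -> (1 <= n)%N -> (k <= n)%N ->
  into_singletons piX -> nlabelled piX = k ->
  (k = 0%N ->
     P0 piX = (\sum_(0 <= j < n) 'C(n, j) * Bell (n - j))%N /\
     (\sum_(0 <= j < n) 'C(n, j) * Bell (n - j))%N = (Bell n.+1 - 1)%N) /\
  ((1 <= k)%N ->
     P0 piX = (\sum_(0 <= j < (n - k).+1) 'C(n - k, j) * Bell (n - j))%N).
Proof.
move=> cX n0 kn single hk; have cb := card_into_singletons single.
have cu : #|unlab piX| = n - k by rewrite -cX -cb card_blocks hk addKn.
rewrite P0E cu cb cX; split=> [k0|k1].
  rewrite k0 subn0; split.
    (* The term [j = n] vanishes: all singletons would be merged without a label. *)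
    rewrite big_nat_recr //= ltnn mul0n muln0 addn0; apply: eq_big_nat => j /andP[_ ->].
    by rewrite mul1n.
  (* After reversing the Bell recursion, its last term is ['C(n, 0) * Bell 0 = 1], the one
     subtracted. *)
  rewrite Bell_rec [in RHS]big_nat_rev /= add0n big_nat_recr //=.
  rewrite subnn bin0 Bell0 addnK; apply: eq_big_nat => j /andP[_ jn].
  by rewrite subSS bin_sub // ltnW.
apply: eq_big_nat => j /andP[_]; rewrite ltnS => jk.
(* As [k] is positive, [j <= n - k < n] and the factor is 1. *)
by rewrite (leq_ltn_trans jk) ?mul1n // ltn_subrL k1.
Qed.
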